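(* For all real numbers $K\geq 1$ and $\epsilon>0$ and every natural number $r\geq 2$ there exists a natural number $n=n(K,\epsilon,r)$ such that the following holds. Let $G$ be any (possibly infinite) group and let $A\subseteq G$ be a finite $r$-stable subset with tripling $K$, i.e. $|A\cdot A\cdot A|\leq K|A|$. Then there is a subgroup $H$ of $G$ with $H\subseteq A\cdot A^{-1}$ and a subset $C\subseteq A$ with $|C|\leq n$ such that $A\subseteq C\cdot H$. Moreover, there exists $C'\subseteq C$ such that \[ |A \,\triangle\, (C'\cdot H)|\leq \epsilon |H|,\] and in particular $|A \,\triangle\, (C'\cdot H)|\leq \epsilon K^2 |A|$.
   Context: A subset $A$ of a group $G$ is called $r$-stable if there are no elements $a_1,\ldots,a_r,b_1,\ldots,b_r\in G$ such that for all $1\le i,j\le r$: $b_j\cdot a_i\in A$ if and only if $i\leq j$. Here $X\cdot Y=\{xy: x\in X, y\in Y\}$, $A^{-1}=\{a^{-1}:a\in A\}$, and $\triangle$ denotes symmetric difference. *)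

(* Defs.v *)
From mathcomp Require Import all_boot all_order all_algebra finmap reals.

Set Implicit Arguments.
Unset Strict Implicit.
Unset Printing Implicit Defensive.

Local Open Scope fset_scope.

(* [groupType] covers infinite and noncommutative groups; its choice structure
   is no restriction, since classically every type carries one. *)

Definition fsmul (G : groupType) (A B : {fset G}) : {fset G} :=
  [fset (x * y)%g | x in A, y in B].

Definition fsinv (G : groupType) (A : {fset G}) : {fset G} :=
  [fset (x^-1)%g | x in A].

Definition fsymdiff (T : choiceType) (A B : {fset T}) : {fset T} :=
  (A `\` B) `|` (B `\` A).

(* Indices run over 0, ..., r-1 instead of 1, ..., r. *)
Definition stable (G : groupType) (r : nat) (A : {fset G}) : Prop :=
  ~ exists a b : 'I_r -> G,
      forall i j : 'I_r, ((b j * a i)%g \in A) = (i <= j)%N.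

(* Main.v *)
Require Import Defs.
From mathcomp Require Import all_boot all_order all_algebra finmap reals.
From mathcomp Require Import boolp zify.

Set Implicit Arguments.
Unset Strict Implicit.
Unset Printing Implicit Defensive.

Local Open Scope fset_scope.
Local Open Scope nat_scope.

(** Let [d g = |A \triangle A g|].  If [d] takes values at many widely separated
    scales, then products of elements [g] witnessing these values give right
    translates of [A] that form a full binary tree, and a tall tree contains a
    long ladder, contradicting stability.  Hence at some scale, bounded in terms
    of [K], [eps] and [r], the condition [d g <= |A| / p] already implies the
    much stronger [d g <= |A| / q]; as [d] is subadditive, such [g] form a
    subgroup [H0].  The translates [A g] with [g] in [A] all lie in [A A], so if
    they were pairwise far apart then averaging would again give a tall tree;
    hence [A] is covered by boundedly many right cosets of [H0].  Averaging
    [d] over [H0] shows that [A] is close to the union of the left cosets of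
    [H0] that it fills by more than half.  For such a coset [c H0], the group
    [c H0 c^-1] is contained in [A A^-1], and small doubling makes the index of
    [H = H0 \cap c H0 c^-1] in [H0], and the number of left cosets of [H] that
    meet [A], bounded. *)

(** * Trees and ladders *)

(* Shelah's 2-rank: [P] contains the leaves of a full binary tree of height [n]
   with nodes in [Q], where [R] between a node and a leaf decides the branch. *)
Fixpoint has_tree (X Y : Type) (R : X -> Y -> bool) (n : nat)
    (Q : X -> Prop) (P : Y -> Prop) : Prop :=
  if n is m.+1 then
    exists2 x, Q x & has_tree R m Q (fun y => P y /\ R x y) /\
                     has_tree R m Q (fun y => P y /\ ~~ R x y)
  else exists y, P y.

Lemma has_tree_sub (X Y : Type) (R : X -> Y -> bool) (n : nat)
    (Q Q' : X -> Prop) (P P' : Y -> Prop) :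
  (forall x, Q x -> Q' x) -> (forall y, P y -> P' y) ->
  has_tree R n Q P -> has_tree R n Q' P'.
Proof.
move=> QQ'; elim: n P P' => [|n IHn] P P' PP' /=.
  by case=> y /PP'; exists y.
case=> x /QQ' Qx [T1 T0]; exists x => //; split.
  by apply: IHn T1 => y [/PP' ? ?]; split.
by apply: IHn T0 => y [/PP' ? ?]; split.
Qed.

Lemma has_tree_nonempty (X Y : Type) (R : X -> Y -> bool) (n : nat)
    (Q : X -> Prop) (P : Y -> Prop) :
  has_tree R n Q P -> exists y, P y.
Proof.
elim: n P => [|n IHn] P //= [x _ [/IHn [y [Py _]] _]].
by exists y.
Qed.

(** Induction on both heights. If the root satisfies [U], either both halves contain a tree in [U]
    one level lower, which the root completes, or some half already contains the tree outside [U];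
    the other case is symmetric. *)
Lemma has_tree_ramsey (X Y : Type) (R : X -> Y -> bool) (U : pred X)
    (m n : nat) (Q : X -> Prop) (P : Y -> Prop) :
  has_tree R (m + n) Q P ->
  has_tree R m (fun x => Q x /\ U x) P \/
  has_tree R n (fun x => Q x /\ ~~ U x) P.
Proof.
elim: m n P => [|m IHm] n P.
  by move=> /has_tree_nonempty; left.
elim: n P => [|n IHn] P.
  by move=> /has_tree_nonempty; right.
rewrite -[m.+1 + n.+1]/((m + n.+1).+1) => -[x Qx []]; case Ux: (U x).
  move=> /IHm[T1|T1] /IHm[T0|T0].
  - by left; exists x.
  - by right; apply: has_tree_sub T0 => // y [].
  - by right; apply: has_tree_sub T1 => // y [].
  - by right; apply: has_tree_sub T0 => // y [].
rewrite -addSnnS => /IHn[T1|T1] /IHn[T0|T0].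
- by left; apply: has_tree_sub T0 => // y [].
- by left; apply: has_tree_sub T1 => // y [].
- by left; apply: has_tree_sub T0 => // y [].
- by right; exists x => //; rewrite Ux.
Qed.

(** The order is a parameter because [leq] suits extension at the bottom and [ltn] extension at the
    top. *)
Definition ladder (X Y : Type) (R : X -> Y -> bool) (Q : X -> Prop)
    (P : Y -> Prop) (le : rel nat) (k : nat) : Prop :=
  exists (a : nat -> Y) (b : nat -> X), forall i j, i < k -> j < k ->
    [/\ P (a i), Q (b j) & R (b j) (a i) = le i j].

Lemma ladder_sub (X Y : Type) (R : X -> Y -> bool) (Q Q' : X -> Prop)
    (P P' : Y -> Prop) (le : rel nat) (k : nat) :
  (forall x, Q x -> Q' x) -> (forall y, P y -> P' y) ->
  ladder R Q P le k -> ladder R Q' P' le k.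
Proof.
move=> QQ' PP' [a [b ab]]; exists a, b => i j ik jk.
by have [/PP' ? /QQ' ? ?] := ab i j ik jk.
Qed.

(** Each of the two Ramsey outcomes must leave a root above halves of height [ladder_height t], so
    the Ramsey step is fed twice [(ladder_height t).+1]. *)
Fixpoint ladder_height (s : nat) : nat :=
  if s is t.+1 then (ladder_height t).+1 + (ladder_height t).+1 else 0.

(* Fix a leaf y.  By Ramsey for the nodes of the tree, there is a large subtree
   on whose nodes R(., y) is constant; its root x and y then extend a ladder
   found in one half of the subtree, at the bottom if the constant is true and
   at the top if it is false. *)
Lemma tree_ladder (X Y : Type) (R : X -> Y -> bool) (x0 : X) (p q : nat)
    (Q : X -> Prop) (P : Y -> Prop) :
  has_tree R (ladder_height (p + q)) Q P ->
  ladder R Q P leq p \/ ladder R Q P ltn q.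
Proof.
move Es : (p + q) => s; elim: s p q Es Q P => [|s IHs] p q Es Q P T.
  have [y Py] := has_tree_nonempty T.
  by left; exists (fun=> y), (fun=> x0) => i j; lia.
have [y Py] := has_tree_nonempty T.
case: p Es => [|p] Es; first by left; exists (fun=> y), (fun=> x0).
case: q Es => [|q] Es; first by right; exists (fun=> y), (fun=> x0).
have [T'|T'] := has_tree_ramsey (fun x => R x y) T.
- have [x [Qx Rxy] [_ T0]] := T'.
  have [|[a [b ab]]|L] := IHs p q.+1 _ _ _ T0; first lia; last first.
    by right; apply: ladder_sub L => ? [].
  left; exists (fun i => if i is i'.+1 then a i' else y).
  exists (fun j => if j is j'.+1 then b j' else x) => -[|i] [|j] ip jp.
  + by split.
  + by have [//|//|_ [? ?] _] := ab j j; split.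
  + have [//|//|[? /negPf Rxa] _ _] := ab i i.
    by split; rewrite // Rxa.
  + by have [//|//|[? _] [? _] ?] := ab i j; split.
- have [x [Qx /negPf Rxy] [T1 _]] := T'.
  have [|L|[a [b ab]]] := IHs p.+1 q _ _ _ T1; first lia.
    by left; apply: ladder_sub L => ? [].
  right; exists (fun i => if i < q then a i else y).
  exists (fun j => if j < q then b j else x) => i j iq jq.
  case: (ltnP i q) => [iq'|qi]; case: (ltnP j q) => [jq'|qj].
  + by have [//|//|[? _] [? _] ?] := ab i j; split.
  + by have [//|//|[? ?] _ _] := ab i i; split => //; lia.
  + have [//|//|_ [? /negPf Rby] _] := ab j j; split => //; rewrite Rby; lia.
  + by split => //; rewrite Rxy; lia.
Qed.

(** The point [x] lies in [A g]: nodes are points and leaves are right translates of [A]. *)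
Definition translate_rel (G : groupType) (A : {fset G}) (x g : G) : bool :=
  (x * g^-1)%g \in A.

Lemma stable_no_tree (G : groupType) (r : nat) (A : {fset G}) (P : G -> Prop) :
  stable r A ->
  ~ has_tree (translate_rel A) (ladder_height (r + r.+1)) (fun=> True) P.
Proof.
move=> stA /(tree_ladder 1%g)[[a [b ab]]|[a [b ab]]]; apply: stA.
  exists (fun i => (a i)^-1)%g, (fun j => b j) => i j.
  by have [] := ab i j (ltn_ord i) (ltn_ord j).
(* A strict ladder of length [r.+1] drops its first [b], as [i < j.+1] means [i <= j]. *)
exists (fun i => (a i)^-1)%g, (fun j => b j.+1) => i j.
by have [||_ _] := ab i j.+1; rewrite ?ltnS // ltnW.
Qed.

(** * Right translates *)

Lemma in_fsymdiff (T : choiceType) (A B : {fset T}) (x : T) :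
  (x \in fsymdiff A B) = (x \in A) (+) (x \in B).
Proof. by rewrite !inE; case: (x \in A); case: (x \in B). Qed.

Lemma fsymdiffC (T : choiceType) (A B : {fset T}) :
  fsymdiff A B = fsymdiff B A.
Proof. by apply/fsetP => x; rewrite !in_fsymdiff addbC. Qed.

Lemma fsymdiff_triangle (T : choiceType) (B A C : {fset T}) :
  #|` fsymdiff A C| <= #|` fsymdiff A B| + #|` fsymdiff B C|.
Proof.
apply: leq_trans (leq_card_fsetU _ _); apply/fsubset_leq_card/fsubsetP => x.
rewrite in_fsetU !in_fsymdiff.
by case: (x \in A); case: (x \in B); case: (x \in C).
Qed.

Definition rtranslate (G : groupType) (A : {fset G}) (g : G) : {fset G} :=
  [fset (x * g)%g | x in A].

Lemma in_rtranslate (G : groupType) (A : {fset G}) (g x : G) :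
  (x \in rtranslate A g) = ((x * g^-1)%g \in A).
Proof.
apply/imfsetP/idP => [[y /= yA ->]|xA]; first by rewrite mulgK.
by exists (x * g^-1)%g => //; rewrite mulgVK.
Qed.

Lemma card_rtranslate (G : groupType) (A : {fset G}) (g : G) :
  #|` rtranslate A g| = #|` A|.
Proof. by apply: card_imfset; apply: mulIg. Qed.

(** This is the function [d] of the overview. Right translation preserves the distance between
    translates, which makes [d] symmetric and subadditive. *)
Definition shift (G : groupType) (A : {fset G}) (g : G) : nat :=
  #|` fsymdiff A (rtranslate A g)|.

Lemma card_fsymdiff_rtranslate (G : groupType) (A : {fset G}) (g h : G) :
  #|` fsymdiff (rtranslate A g) (rtranslate A h)| = shift A (g * h^-1)%g.
Proof.
rewrite /shift fsymdiffC -[RHS](card_rtranslate _ h); congr #|` _|.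
apply/fsetP => x; rewrite !(in_rtranslate, in_fsymdiff).
by rewrite invgM invgK mulgA mulgVK.
Qed.

Lemma shift1 (G : groupType) (A : {fset G}) : shift A 1%g = 0.
Proof.
apply/eqP; rewrite cardfs_eq0; apply/eqP/fsetP => x.
by rewrite in_fsymdiff in_rtranslate invg1 mulg1 addbb.
Qed.

Lemma shiftV (G : groupType) (A : {fset G}) (g : G) :
  shift A (g^-1)%g = shift A g.
Proof.
rewrite -[(g^-1)%g]mul1g -card_fsymdiff_rtranslate fsymdiffC.
by rewrite card_fsymdiff_rtranslate invg1 mulg1.
Qed.

Lemma shiftM (G : groupType) (A : {fset G}) (g h : G) :
  shift A (g * h)%g <= shift A g + shift A h.
Proof.
rewrite -{1}[h]invgK -card_fsymdiff_rtranslate.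
apply: leq_trans (fsymdiff_triangle (rtranslate A 1%g) _ _) _.
by rewrite !card_fsymdiff_rtranslate invg1 mulg1 mul1g invgK.
Qed.

Lemma exists_outside (I : eqType) (T : choiceType) (L : seq I)
    (F : I -> {fset T}) (D : {fset T}) (s : nat) :
  (forall l, l \in L -> #|` F l| <= s) -> size L * s < #|` D| ->
  exists2 x, x \in D & forall l, l \in L -> x \notin F l.
Proof.
elim: L D => [|l L IHL] D Fs /=.
  by rewrite mul0n cardfs_gt0 => /fset0Pn[x xD]; exists x.
rewrite mulSn => szD; have Fl : #|` F l| <= s by apply: Fs; rewrite mem_head.
have [||x] := IHL (D `\` F l).
- by move=> l' l'L; apply: Fs; rewrite inE l'L orbT.
- have := cardfsID (F l) D.
  have /fsubset_leq_card : D `&` F l `<=` F l by apply: fsubsetIr.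
  lia.
rewrite inE => /andP[xFl xD] xL; exists x => // l'.
by rewrite inE => /predU1P[->|/xL].
Qed.

(** Nodes and leaves move together: [x h] lies in [A y h] exactly when [x] lies in [A y]. *)
Lemma has_tree_rtranslate (G : groupType) (A : {fset G}) (n : nat)
    (P : G -> Prop) (h : G) :
  has_tree (translate_rel A) n (fun=> True) P ->
  has_tree (translate_rel A) n (fun=> True) (fun y => P (y * h^-1)%g).
Proof.
elim: n P => [|n IHn] P /=; first by case=> y Py; exists (y * h)%g; rewrite mulgK.
have shiftE x y : translate_rel A (x * h)%g y = translate_rel A x (y * h^-1)%g.
  by rewrite /translate_rel invgM invgK mulgA.
case=> x _ [T1 T0]; exists (x * h)%g => //; split.
  by apply: has_tree_sub (IHn _ T1) => // y; rewrite shiftE.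
by apply: has_tree_sub (IHn _ T0) => // y; rewrite shiftE.
Qed.

(* A point at which [A] and [A h] differ, taken outside the much smaller
   differences between [A] and [A l] and between [A h] and [A l h], separates
   [L] from [L h]. *)
Lemma tree_growth (G : groupType) (A : {fset G}) (L : seq G) (h : G)
    (n s : nat) :
  has_tree (translate_rel A) n (fun=> True) (fun y => y \in L) ->
  (forall l, l \in L -> shift A l <= s) ->
  size L * s.*2 < shift A h ->
  has_tree (translate_rel A) n.+1 (fun=> True)
    (fun y => y \in L ++ [seq (l * h)%g | l <- L]).
Proof.
move=> TL Ls Lh.
pose F l := fsymdiff A (rtranslate A l) `|`
  fsymdiff (rtranslate A h) (rtranslate A (l * h)%g).
have [l lL||x] := @exists_outside _ _ L F (fsymdiff A (rtranslate A h)) s.*2.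
- apply: leq_trans (leq_card_fsetU _ _) _; rewrite -addnn leq_add ?Ls //.
  by rewrite fsymdiffC card_fsymdiff_rtranslate mulgK Ls.
- by [].
rewrite in_fsymdiff in_rtranslate => xD xF.
have TLh : has_tree (translate_rel A) n (fun=> True)
    (fun y => (y * h^-1)%g \in L) by apply: (has_tree_rtranslate (P := fun y => y \in L)).
have xl l : l \in L -> translate_rel A x l = (x \in A).
  move=> /xF; rewrite in_fsetU negb_or !in_fsymdiff !negb_add in_rtranslate.
  by case/andP=> /eqP.
have xlh l : (l * h^-1)%g \in L -> translate_rel A x l = ((x * h^-1)%g \in A).
  move=> /xF; rewrite in_fsetU negb_or !in_fsymdiff !negb_add mulgVK.
  by rewrite !in_rtranslate => /andP[_ /eqP].
exists x => //; case xA: (x \in A) xD xl => /= xhA xl.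
  split; [apply: has_tree_sub TL|apply: has_tree_sub TLh] => // y yL.
    by rewrite mem_cat yL xl.
  rewrite mem_cat xlh //; split => //.
  by apply/orP; right; apply/mapP; exists (y * h^-1)%g; rewrite ?mulgVK.
split; [apply: has_tree_sub TLh|apply: has_tree_sub TL] => // y yL.
  rewrite mem_cat xlh //; split => //.
  by apply/orP; right; apply/mapP; exists (y * h^-1)%g; rewrite ?mulgVK.
by rewrite mem_cat yL xl.
Qed.

(* Otherwise each of the [m] scales contributes one more level to a tree, from
   the smallest shift to the largest. *)
Lemma scale_gap (G : groupType) (A : {fset G}) (r : nat) (p q : nat -> nat) :
  let m := ladder_height (r + r.+1) in
  stable r A -> (forall i, 2 ^ m.+3 * q i <= p i.+1) ->
  exists2 i, i < m &
    forall h, shift A h * p i <= #|` A| -> shift A h * q i <= #|` A|.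
Proof.
move=> m stA pq; apply: contrapT => nogap.
have jump i : i < m -> exists h,
    shift A h * p i <= #|` A| /\ #|` A| < shift A h * q i.
  move=> im; apply: contrapT => noh; apply: nogap; exists i => // h hp.
  by rewrite leqNgt; apply/negP => hq; apply: noh; exists h.
(* Scales are used from [m - 1] down to [0], so from small shifts to large ones; [s] bounds the
   shifts of the leaves collected so far. *)
suff /(_ m (leqnn m)) [L [s [TL _ _ _]]] : forall j, j <= m -> exists L s,
    [/\ has_tree (translate_rel A) j (fun=> True) (fun y => y \in L),
        size L = 2 ^ j, forall l, l \in L -> shift A l <= s &
        s * p (m - j) <= #|` A|.*2].
  exact: (stable_no_tree stA TL).
elim=> [_|j IHj jm].
  exists [:: 1%g], 0; split; rewrite ?mul0n //.
    by exists 1%g; rewrite mem_head.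
  by move=> l; rewrite inE => /eqP->; rewrite shift1.
have [L [s [TL szL Ls sp]]] := IHj (ltnW jm).
have mj : m - j = (m - j.+1).+1 by lia.
have [|h [hp hq]] := jump (m - j.+1); first by lia.
(* The factor [2 ^ m.+3] absorbs the number [2 ^ j] of leaves and the doublings of [s] and of the
   size of [A]. *)
have sL : size L * s.*2 < shift A h.
  have le1 : s * (2 ^ m.+3 * q (m - j.+1)) <= #|` A|.*2.
    by apply: leq_trans sp; rewrite leq_mul2l mj pq orbT.
  have le2 : 2 ^ j <= 2 ^ m by rewrite leq_exp2l // ltnW.
  rewrite szL ltnNge; apply/negP => le3; move: le1 hq; rewrite !expnS.
  move: (q _) (2 ^ j) (2 ^ m) le2 le3 => c a b ab da le1 hq.
  have le4 : shift A h * c <= b * s.*2 * c.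
    by rewrite leq_mul2r (leq_trans da) ?orbT // leq_mul2r ab orbT.
  nia.
exists (L ++ [seq (l * h)%g | l <- L]), (s + shift A h); split.
- exact: tree_growth TL Ls sL.
- by rewrite size_cat size_map szL expnS; lia.
- move=> l; rewrite mem_cat => /orP[/Ls|/mapP[l' /Ls l's ->]]; first lia.
  by apply: leq_trans (shiftM _ _ _) _; rewrite leq_add2r.
- have : s <= shift A h by move: sL; rewrite szL; have := expn_gt0 2 j; nia.
  move: hp; move: (p _) => c; nia.
Qed.

(** * Separated families of translates *)

Lemma card_fsetI_sum (T : choiceType) (B S : {fset T}) :
  #|` B `&` S| = \sum_(x <- B) (x \in S : nat).
Proof.
transitivity (\sum_(x <- B | x \in S) 1); last by rewrite big_mkcond.
rewrite sum1_count -size_filter.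
apply/perm_size/uniq_perm; rewrite ?filter_uniq ?fset_uniq // => x.
by rewrite mem_filter inE andbC.
Qed.

(* Double counting of the triples [(x, g, h)] with [x] separating [A g] from
   [A h]. *)
Lemma separated_split (G : groupType) (A F : {fset G}) (k p u : nat) :
  F `<=` A -> 0 < k -> 0 < p -> 2 < #|` F| ->
  #|` fsmul A A| <= k * #|` A| ->
  {in F &, forall g h, shift A (g * h^-1)%g * p <= #|` A| -> g = h} ->
  u * (4 * k * p) <= #|` F| ->
  exists x, u <= \sum_(g <- F) (translate_rel A x g : nat) /\
            u <= \sum_(g <- F) (~~ translate_rel A x g : nat).
Proof.
move=> FA k0 p0 F2 AAk sepF uF; apply: contrapT => nox.
pose f1 x := \sum_(g <- F) (translate_rel A x g : nat).
pose f0 x := \sum_(g <- F) (~~ translate_rel A x g : nat).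
have sum1F : \sum_(g <- F) 1 = #|` F| by rewrite card_fset_sum1.
have f1F x : f1 x <= #|` F|.
  by rewrite -sum1F leq_sum // => g _; case: translate_rel.
have f0F x : f0 x <= #|` F|.
  by rewrite -sum1F leq_sum // => g _; case: translate_rel.
(* At each [x] one count is below [u], hence at most [|F| / (4 k p)], and the other is at most
   [|F|]. *)
have f10 x : f1 x * f0 x * (4 * k * p) <= #|` F| ^ 2.
  have [lt1|ge1] := ltnP (f1 x) u.
    rewrite mulnAC -mulnn leq_mul //; apply: leq_trans uF.
    by rewrite leq_mul2r (ltnW lt1) orbT.
  have [lt0|ge0] := ltnP (f0 x) u; last by case: nox; exists x.
  rewrite -mulnA -mulnn leq_mul //; apply: leq_trans uF.
  by rewrite leq_mul2r (ltnW lt0) orbT.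
have dist g h : g \in F -> h \in F -> shift A (g * h^-1)%g =
    \sum_(x <- fsmul A A) (translate_rel A x g (+) translate_rel A x h : nat).
  move=> gF hF; rewrite -card_fsymdiff_rtranslate.
  have /fsetIidPr <- : fsymdiff (rtranslate A g) (rtranslate A h) `<=` fsmul A A.
    apply/fsubsetP => x; rewrite in_fsetU !in_fsetD => /orP[] /andP[_].
      move=> /imfsetP[y /= yA ->]; apply/imfset2P; exists y => //.
      by exists g; rewrite //= (fsubsetP FA).
    move=> /imfsetP[y /= yA ->]; apply/imfset2P; exists y => //.
    by exists h; rewrite //= (fsubsetP FA).
  rewrite card_fsetI_sum; apply: eq_bigr => x _.
  by rewrite in_fsymdiff !in_rtranslate.
have total : \sum_(g <- F) \sum_(h <- F) shift A (g * h^-1)%g =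
    \sum_(x <- fsmul A A) (f1 x * f0 x).*2.
  under eq_big_seq => g gF do under eq_big_seq => h hF do rewrite (dist g h gF hF).
  under eq_bigr => g _ do rewrite exchange_big.
  rewrite exchange_big; apply: eq_bigr => x _ /=.
  rewrite -addnn {2}[f1 x * f0 x]mulnC !big_distrlr -big_split /=.
  apply: eq_bigr => g _; rewrite -big_split /=; apply: eq_bigr => h _.
  by do 2 case: translate_rel.
(* Each [h] in [F] other than [g] is at distance above [|A| / p]; the extra [|A|] pays for
   [h = g]. *)
have lower g : g \in F ->
    #|` F| * #|` A| <= p * \sum_(h <- F) shift A (g * h^-1)%g + #|` A|.
  move=> gF; rewrite big_distrr /=.
  have {2}-> : #|` A| = \sum_(h <- F) (h \in [fset g]) * #|` A|.
    rewrite -big_distrl -card_fsetI_sum /=.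
    by have /fsetIidPr -> : [fset g] `<=` F; rewrite ?fsub1set // cardfs1 mul1n.
  rewrite -big_split /= -sum1F big_distrl /= big_seq [leqRHS]big_seq.
  apply: leq_sum => h hF; rewrite inE mul1n.
  have [->|neq] := eqVneq h g; first by rewrite mul1n leq_addl.
  rewrite addn0 mulnC leqNgt; apply/negP => /ltnW /sepF.
  by move=> /(_ gF hF) gh; rewrite gh eqxx in neq.
have lowerT : #|` F| ^ 2 * #|` A| <=
    p * (\sum_(x <- fsmul A A) f1 x * f0 x).*2 + #|` F| * #|` A|.
  have -> : (\sum_(x <- fsmul A A) f1 x * f0 x).*2 =
      \sum_(x <- fsmul A A) (f1 x * f0 x).*2.
    by rewrite -mul2n big_distrr /=; apply: eq_bigr => x _; rewrite mul2n.
  rewrite -total -mulnn -mulnA -{1}sum1F -[in X in _ <= _ + X]sum1F.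
  rewrite !big_distrl big_distrr -big_split /= big_seq [leqRHS]big_seq.
  by apply: leq_sum => g /lower; rewrite !mul1n.
have upper : (\sum_(x <- fsmul A A) f1 x * f0 x) * (4 * k * p) <=
    k * #|` A| * #|` F| ^ 2.
  rewrite big_distrl /=; apply: (@leq_trans (\sum_(x <- fsmul A A) #|` F| ^ 2)).
    by apply: leq_sum => x _.
  under eq_bigr => x _ do rewrite -[#|` F| ^ 2]mul1n.
  by rewrite -big_distrl -card_fset_sum1 leq_mul2r AAk orbT.
have A0 : 0 < #|` A|.
  by apply: leq_trans (fsubset_leq_card FA); apply: ltn_trans F2.
move: lowerT upper; move: (bigop _ _ _) => M.
set N := #|` F| in F2 *; set a := #|` A| in A0 * => lowerT upper.
(* With [upper] this yields [2 N^2 <= N^2 + 2 N], against [2 < N]. *)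
have : (2 * k) * (N ^ 2 * a) <= (2 * k) * (p * M.*2 + N * a).
  by rewrite leq_mul2l lowerT orbT.
have : 0 < k * a by rewrite muln_gt0 k0.
nia.
Qed.

(** A splitting point serves as root: either part of [F] remains separated and keeps at least a
    fraction [1 / (4 k p)] of it. *)
Lemma separated_tree (G : groupType) (A F : {fset G}) (k p n : nat) :
  F `<=` A -> 0 < k -> 0 < p ->
  #|` fsmul A A| <= k * #|` A| ->
  {in F &, forall g h, shift A (g * h^-1)%g * p <= #|` A| -> g = h} ->
  (4 * k * p) ^ n <= #|` F| ->
  has_tree (translate_rel A) n (fun=> True) (fun y => y \in F).
Proof.
move=> FA k0 p0 AAk; elim: n F FA => [|n IHn] F FA sepF.
  by rewrite expn0 cardfs_gt0 => /fset0Pn[x xF]; exists x.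
rewrite expnSr => szF.
have c4 : 4 <= 4 * k * p by rewrite -mulnA leq_pmulr // muln_gt0 k0.
have [|x [x1 x0]] := separated_split FA k0 p0 _ AAk sepF szF.
  apply: leq_trans szF; apply: leq_trans (ltnW c4) _.
  by rewrite leq_pmull // expn_gt0 (leq_trans _ c4).
have IH (b : G -> bool) : (4 * k * p) ^ n <= \sum_(g <- F) (b g : nat) ->
    has_tree (translate_rel A) n (fun=> True) (fun y => y \in F /\ b y).
  move=> szb.
  have bF : [fset g in F | b g] `<=` F by apply: fset_sub.
  apply: has_tree_sub (IHn [fset g in F | b g] (fsubset_trans bF FA) _ _) => //.
  - by move=> y; rewrite !inE => /andP[].
  - by move=> g h /(fsubsetP bF) gF /(fsubsetP bF) hF; apply: sepF.
  apply: leq_trans szb _; rewrite -(fsetIidPr bF) card_fsetI_sum.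
  rewrite big_seq [leqRHS]big_seq; apply: leq_sum => g gF.
  by rewrite !inE gF.
by exists x => //; split; apply: IH.
Qed.

(** * Counting in products and choosing representatives *)

Lemma card_fsetM (T T' : choiceType) (A : {fset T}) (B : {fset T'}) :
  #|` A `*` B| = #|` A| * #|` B|.
Proof.
rewrite -(size_allpairs pair); apply/perm_size/uniq_perm.
- exact: fset_uniq.
- by apply: allpairs_uniq; rewrite ?fset_uniq // => -[? ?] [? ?] _ _ [-> ->].
move=> [x y]; rewrite in_fsetM /=; apply/andP/allpairsP => [[xA yB]|].
  by exists (x, y).
by case=> -[x' y'] [/= ? ? [-> ->]].
Qed.

Lemma leq_card_in_fset (T T' : choiceType) (f : T -> T') (A : {fset T})
    (B : {fset T'}) :
  {in A, forall x, f x \in B} -> {in A &, injective f} -> #|` A| <= #|` B|.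
Proof.
move=> fAB injf; rewrite -(card_in_imfset imfset_key injf).
by apply/fsubset_leq_card/fsubsetP => _ /imfsetP[x /= xA ->]; apply: fAB.
Qed.

Lemma in_fsmul (G : groupType) (A B : {fset G}) (x y : G) :
  x \in A -> y \in B -> (x * y)%g \in fsmul A B.
Proof. by move=> xA yB; apply/imfset2P; exists x => //; exists y. Qed.

Lemma fsmulP (G : groupType) (A B : {fset G}) (z : G) :
  reflect (exists x y, [/\ x \in A, y \in B & z = (x * y)%g]) (z \in fsmul A B).
Proof.
apply: (iffP (imfset2P _ _ _ _ _)) => [[x /= xA [y /= yB ->]]|[x [y [xA yB ->]]]].
  by exists x, y.
by exists x => //; exists y.
Qed.

Lemma card_fsmul_le (G : groupType) (A B : {fset G}) :
  #|` fsmul A B| <= #|` A| * #|` B|.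
Proof.
rewrite -card_fsetM.
have : #|` [fset (z.1 * z.2)%g | z in A `*` B]| <= #|` A `*` B|.
  exact: leq_imfset_card.
apply: leq_trans.
apply/fsubset_leq_card/fsubsetP => _ /fsmulP[x [y [xA yB ->]]].
by apply/imfsetP; exists (x, y); rewrite //= in_fsetM xA.
Qed.

(** Greedy choice: take a point, discard its neighbours, repeat. For congruence modulo a subgroup,
    [F] is a set of coset representatives. *)
Lemma maximal_separated (T : choiceType) (A : {fset T}) (e : rel T) :
  reflexive e -> symmetric e ->
  exists F : {fset T}, [/\ F `<=` A, {in F &, forall x y, e x y -> x = y} &
                         {in A, forall x, exists2 y, y \in F & e x y}].
Proof.
move=> erefl esym; have [n] := ubnP #|` A|.
elim: n A => // n IHn A szA.
have [->|/fset0Pn[a aA]] := eqVneq A fset0.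
  by exists fset0; split=> // x; rewrite inE.
have A'A : [fset x in A | ~~ e x a] `<=` A by apply: fset_sub.
have [|F [FA sepF covF]] := IHn [fset x in A | ~~ e x a].
  rewrite -ltnS; apply: leq_trans szA; rewrite ltnS; apply: fproper_ltn_card.
  rewrite fproperE A'A; apply/negP => /fsubsetP /(_ a aA).
  by rewrite !inE erefl andbF.
have nF x : x \in F -> ~~ e x a.
  by move=> /(fsubsetP FA); rewrite !inE => /andP[].
exists (a |` F); split.
- by apply/fsubsetP => x /fset1UP[->|/(fsubsetP FA)/(fsubsetP A'A)].
- move=> x y /fset1UP[->|xF] /fset1UP[->|yF] //; last exact: sepF.
    by rewrite esym (negPf (nF y yF)).
  by rewrite (negPf (nF x xF)).
- move=> x xA; have [exa|nexa] := boolP (e x a).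
    by exists a; rewrite ?fset1U1.
  have [|y yF exy] := covF x; first by rewrite !inE xA.
  by exists y; rewrite // fset1Ur.
Qed.

Lemma card_sep_sum (T : choiceType) (B : {fset T}) (b : pred T) :
  #|` [fset x in B | b x]| = \sum_(x <- B) (b x : nat).
Proof.
have -> : [fset x in B | b x] = B `&` [fset x in B | b x].
  by apply/esym/fsetIidPr/fset_sub.
rewrite card_fsetI_sum big_seq [RHS]big_seq; apply: eq_bigr => x xB.
by rewrite !inE xB.
Qed.

(** * Passing to a subgroup *)

(** More than half of the coset [x H] lies in [A]; [x] itself may lie outside [A]. *)
Definition majority (G : groupType) (A H : {fset G}) (x : G) : bool :=
  #|` H| < #|` [fset h in H | (x * h)%g \in A]|.*2.

Lemma majorityM (G : groupType) (A H : {fset G}) (x u : G) :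
  group_closed [in H] -> u \in H -> majority A H x -> majority A H (x * u)%g.
Proof.
move=> gH uH majx; apply: leq_trans majx _; rewrite leq_double.
apply: (leq_card_in_fset (f := fun h => (u^-1 * h)%g)) => [h|? ? _ _ /mulgI //].
rewrite !inE => /andP[hH xh]; rewrite -mulgA mulVKg xh andbT.
by apply: (group_closedM gH) => //; apply: (group_closedV gH).
Qed.

(** Two subsets of [H] larger than half of it intersect. Consequently [x y^-1], the quotient of
    [x h] by [y h], lies in [A A^-1]. *)
Lemma majority_meet (G : groupType) (A H : {fset G}) (x y : G) :
  majority A H x -> majority A H y ->
  exists h, [/\ h \in H, (x * h)%g \in A & (y * h)%g \in A].
Proof.
rewrite /majority; set X := [fset h in H | _]; set Y := [fset h in H | _].
move=> majx majy; have := cardfsUI X Y.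
have : #|` X `|` Y| <= #|` H|.
  by apply: fsubset_leq_card; rewrite fsubUset !fset_sub.
move=> leH eqUI; have : 0 < #|` X `&` Y| by lia.
rewrite cardfs_gt0 => /fset0Pn[h]; rewrite !inE.
by case/andP=> /andP[hH xh] /andP[_ yh]; exists h.
Qed.

(** Double counting of pairs [(x, h)] for which [A] separates [x] from [x h]: each [x] in [S] has at
    least [|H| / 2] such [h], and each [h] at most [|A| / q] such [x]. *)
Lemma card_disagree (G : groupType) (A H S : {fset G}) (q : nat) :
  group_closed [in H] ->
  {in H, forall h, shift A h * q <= #|` A|} ->
  {in S, forall x, (x \in A) != majority A H x} ->
  #|` S| * q <= #|` A|.*2.
Proof.
move=> gH Hq Smaj.
have H0 : 0 < #|` H| by rewrite cardfs_gt0; apply/fset0Pn; exists 1%g; case: gH.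
pose d x h : nat := (x \in A) (+) ((x * h)%g \in A).
have dS x : x \in S -> #|` H| <= (\sum_(h <- H) d x h).*2.
  move=> /Smaj; rewrite /majority card_sep_sum /d.
  case: (x \in A); case: ltnP => //= maj _; last exact: ltnW.
  move: maj; rewrite card_fset_sum1.
  have -> : \sum_(h <- H) 1 = \sum_(h <- H) (~~ ((x * h)%g \in A) : nat) +
      \sum_(h <- H) ((x * h)%g \in A : nat).
    by rewrite -big_split; apply: eq_bigr => h _ /=; case: (_ \in A).
  by move: (bigop _ _ _) (bigop _ _ _) => s t; lia.
have dH h : h \in H -> (\sum_(x <- S) d x h) * q <= #|` A|.
  move=> hH; apply: leq_trans (Hq _ (group_closedV gH hH)).
  rewrite leq_mul2r -card_sep_sum; apply/orP; right; apply: fsubset_leq_card.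
  apply/fsubsetP => x; rewrite in_fsymdiff in_rtranslate invgK.
  by rewrite inE => /andP[].
rewrite -(leq_pmul2l H0).
apply: (@leq_trans ((\sum_(x <- S) \sum_(h <- H) d x h).*2 * q)).
  rewrite mulnA leq_mul2r mulnC card_fset_sum1 big_distrl /= -mul2n big_distrr /=.
  rewrite big_seq [leqRHS]big_seq leq_sum ?orbT // => x xS.
  by rewrite mul1n mul2n dS.
rewrite exchange_big /= -doubleMl -doubleMr leq_double big_distrl /=.
rewrite card_fset_sum1 big_distrl /= big_seq [leqRHS]big_seq leq_sum // => h hH.
by rewrite mul1n dH.
Qed.

(** The set is the intersection of [H] and [c H c^-1]. *)
Lemma conjugate_core_closed (G : groupType) (H : {fset G}) (c : G) :
  group_closed [in H] ->
  group_closed [in [fset h in H | (c^-1 * h * c)%g \in H]].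
Proof.
move=> [H1 Hdiv]; split; first by rewrite !inE mulg1 mulVg H1.
move=> u v; rewrite !inE => /andP[uH cuH] /andP[vH cvH].
rewrite Hdiv //=; have := Hdiv _ _ cuH cvH.
by rewrite !invgM invgK !mulgA mulgK.
Qed.

(* The classes of [Y] modulo [H :&: c H c^-1] give disjoint translates of
   [c * Y] in [A * A]. *)
Lemma conjugate_core_index (G : groupType) (A H Y : {fset G}) (c : G) :
  group_closed [in H] -> Y `<=` H -> {in Y, forall y, (c * y)%g \in A} ->
  #|` Y| ^ 2 <= #|` fsmul A A| * #|` [fset h in H | (c^-1 * h * c)%g \in H]|.
Proof.
move=> gH /fsubsetP YH cYA.
have [K1 Kdiv] := conjugate_core_closed c gH.
set K := [fset h in H | _] in K1 Kdiv *.
have KV := group_closedV (conj K1 Kdiv).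
have [|x y|D [/fsubsetP DY sepD covD]] :=
  @maximal_separated _ Y (fun x y => (x^-1 * y)%g \in K).
- by move=> x; rewrite mulVg.
- by apply/idP/idP => /KV; rewrite invgM invgK.
have leY : #|` Y| <= #|` D| * #|` K|.
  apply: leq_trans (card_fsmul_le _ _); apply/fsubset_leq_card/fsubsetP => y yY.
  have [d dD yd] := covD y yY; apply/fsmulP; exists d, (d^-1 * y)%g.
  by split; rewrite ?mulVKg // -[y in X in X \in _]invgK -invgM KV.
have leA : #|` D| * #|` Y| <= #|` fsmul A A|.
  rewrite -card_fsetM.
  apply: (leq_card_in_fset (f := fun z => (c * z.1 * (c * z.2))%g)).
    move=> [d y]; rewrite in_fsetM => /andP[/DY dY yY].
    by apply: in_fsmul; apply: cYA.
  move=> [d y] [d' y']; rewrite !in_fsetM /= => /andP[dD yY] /andP[d'D y'Y] eqz.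
  have eqz' : (d * (c * y) = d' * (c * y'))%g.
    by apply: (mulgI c); rewrite !mulgA in eqz *.
  (* The left side lies in [H] and the right side in [c H c^-1], so [d] and [d'] are congruent
     modulo [K], hence equal. *)
  have dd' : (d'^-1 * d = c * (y' / y) * c^-1)%g.
    apply: (mulgI d'); rewrite mulVKg; apply: (mulIg (c * y)%g).
    by rewrite eqz' !mulgA !mulgVK.
  have ed : d' = d.
    apply: sepD => //; rewrite /K !inE {2}dd' !mulgA mulVg mul1g mulgVK.
    apply/andP; split; last by apply: gH.2; apply: YH.
    by apply: (group_closedM gH); [apply: (group_closedV gH)|]; apply/YH/DY.
  by move: eqz'; rewrite ed => /mulgI/mulgI->.
rewrite -mulnn; apply: leq_trans (_ : #|` D| * #|` K| * #|` Y| <= _).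
  by rewrite leq_mul2r leY orbT.
by rewrite mulnAC leq_mul2r leA orbT.
Qed.

(* The map [(x, h, y) |-> (x c y, y^-1 (c^-1 h c))] is injective: the product
   of its components is [x h c], which determines [x] and [h]. *)
Lemma conjugate_core_cosets (G : groupType) (A C H Y : {fset G}) (c : G) :
  let K := [fset h in H | (c^-1 * h * c)%g \in H] in
  group_closed [in H] -> Y `<=` H -> {in Y, forall y, (c * y)%g \in A} ->
  C `<=` A -> {in C &, forall x y, (x^-1 * y)%g \in K -> x = y} ->
  #|` C| * (#|` K| * #|` Y|) <= #|` fsmul A A| * #|` H|.
Proof.
move=> K gH /fsubsetP YH cYA /fsubsetP CA sepC.
have gK := conjugate_core_closed c gH; rewrite -!card_fsetM.
apply: (leq_card_in_fset
  (f := fun z => (z.1 * (c * z.2.2), z.2.2^-1 * (c^-1 * z.2.1 * c))%g)).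
  move=> [x [h y]]; rewrite !in_fsetM /= => /and3P[xC hK yY].
  rewrite in_fsmul ?(CA x) ?cYA //=; apply: (group_closedM gH).
    by apply: (group_closedV gH); apply: YH.
  by move: hK; rewrite !inE => /andP[].
move=> [x [h y]] [x' [h' y']]; rewrite !in_fsetM /=.
move=> /and3P[xC hK yY] /and3P[x'C h'K y'Y] [e1 e2].
have exh : (x * h = x' * h')%g.
  have := congr2 (fun a b : G => a * b)%g e1 e2.
  by rewrite -!mulgA !mulVKg !mulgA => /mulIg.
have ex : x' = x.
  apply: sepC => //; have -> : (x'^-1 * x = h' / h)%g; last exact: gK.2.
  by apply: (mulgI x'); rewrite mulVKg; apply: (mulIg h); rewrite mulgA mulgVK.
move: exh e1; rewrite ex => /mulgI-> /mulgI/mulgI->.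
by [].
Qed.

Lemma subgroup_structure (G : groupType) (A H0 : {fset G}) (k N q e : nat) :
  A != fset0 -> #|` fsmul A A| <= k * #|` A| ->
  group_closed [in H0] -> {in H0, forall h, shift A h * q <= #|` A|} ->
  #|` A| <= N * #|` H0| -> 2 < q -> 2 * e <= q -> 8 * k * N ^ 2 * e <= q ->
  exists H C : {fset G},
    [/\ group_closed [in H], H `<=` fsmul A (fsinv A), C `<=` A,
        #|` C| <= 8 * k ^ 2 * N ^ 2 & A `<=` fsmul C H] /\
    exists C' : {fset G},
      [/\ C' `<=` C, e * #|` fsymdiff A (fsmul C' H)| <= #|` H| &
          e * #|` fsymdiff A (fsmul C' H)| <= #|` A|].
Proof.
rewrite -cardfs_gt0 => A0 AAk gH0 H0q AN q2 qe qkNe.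
have H00 : 0 < #|` H0|.
  by rewrite cardfs_gt0; apply/fset0Pn; exists 1%g; case: gH0.
(* Otherwise all of [A] disagrees with its majority, and [|A| q <= 2 |A|] contradicts [2 < q]. *)
have [c cA cmaj] : exists2 c, c \in A & majority A H0 c.
  pose S := [fset x in A | ~~ majority A H0 x].
  have [|/fset0Pn[c]] := eqVneq (A `\` S) fset0; last first.
    by rewrite !inE => /andP[/[swap] cA]; rewrite cA negbK; exists c.
  move=> /eqP; rewrite fsetD_eq0 => /fsubset_leq_card AS.
  have : #|` S| * q <= #|` A|.*2.
    apply: (card_disagree gH0 H0q) => x; rewrite !inE => /andP[-> ] /=.
    by case: majority.
  nia.
pose Y := [fset y in H0 | (c * y)%g \in A].
have YH0 : Y `<=` H0 by apply: fset_sub.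
have cYA : {in Y, forall y, (c * y)%g \in A} by move=> y; rewrite !inE => /andP[].
have index := conjugate_core_index gH0 YH0 cYA.
have cosets C := @conjugate_core_cosets _ A C _ _ _ gH0 YH0 cYA.
have gH := conjugate_core_closed c gH0.
set H := [fset h in H0 | _] in index cosets gH.
have HH0 : H `<=` H0 by apply: fset_sub.
have [|x y|C [CA sepC covC]] :=
  @maximal_separated _ A (fun x y => (x^-1 * y)%g \in H).
- by move=> x; rewrite mulVg; case: gH.
- by apply/idP/idP => /(group_closedV gH); rewrite invgM invgK.
have {}cosets := cosets C CA sepC.
have leHY : #|` H0| < #|` Y|.*2 by exact: cmaj.
have H_gt0 : 0 < #|` H| by rewrite cardfs_gt0; apply/fset0Pn; exists 1%g; case: gH.
(* Chain: [|H0|^2 <= 4 |Y|^2 <= 4 |A A| |H| <= 4 k N |H0| |H|]. *)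
have leH0 : #|` H0| <= 4 * k * N * #|` H|.
  rewrite -(leq_pmul2r H00).
  have : #|` H0| ^ 2 <= 4 * #|` Y| ^ 2.
    have -> : 4 * #|` Y| ^ 2 = #|` Y|.*2 ^ 2 by rewrite -mul2n expnMn.
    by rewrite leq_sqr ltnW.
  have : k * #|` A| * #|` H| <= k * (N * #|` H0|) * #|` H|.
    by rewrite leq_mul2r leq_mul2l AN !orbT.
  have : #|` fsmul A A| * #|` H| <= k * #|` A| * #|` H| by rewrite leq_mul2r AAk orbT.
  rewrite -mulnn; nia.
have leA : #|` A| <= 4 * k * N ^ 2 * #|` H|.
  apply: leq_trans AN _; apply: leq_trans (_ : N * (4 * k * N * #|` H|) <= _).
    by rewrite leq_mul2l leH0 orbT.
  by rewrite -mulnn; nia.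
exists H, C; split.
  split=> //.
  (* The cosets of [c] and [h c = c (c^-1 h c)] coincide, so some [w] puts both [c w] and [h c w] in
     [A], and [h] is their quotient. *)
  - apply/fsubsetP => h; rewrite !inE => /andP[hH0 chH0].
    have [w [wH0 cw cuw]] :=
      majority_meet cmaj (majorityM gH0 chH0 cmaj).
    apply/fsmulP; exists (c * (c^-1 * h * c) * w)%g, ((c * w)^-1)%g; split=> //.
      by apply/imfsetP; exists (c * w)%g.
    by rewrite invgM !mulgA mulgK mulgV mul1g mulgK.
  - have leC : #|` C| * #|` H| <= 2 * (k * #|` A|).
      rewrite -(leq_pmul2r H00).
      apply: (@leq_trans (2 * (#|` C| * (#|` H| * #|` Y|)))).
        have : #|` C| * #|` H| * #|` H0| <= #|` C| * #|` H| * #|` Y|.*2.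
          by rewrite leq_mul2l (ltnW leHY) orbT.
        nia.
      rewrite -mulnA leq_mul2l /=; apply: leq_trans cosets _.
      by rewrite leq_mul2r AAk orbT.
    rewrite -(leq_pmul2r H_gt0); apply: leq_trans leC _.
    have : 2 * k * #|` A| <= 2 * k * (4 * k * N ^ 2 * #|` H|).
      by rewrite leq_mul2l leA orbT.
    rewrite -!mulnn; nia.
  - apply/fsubsetP => x xA; have [y yC xy] := covC x xA.
    apply/fsmulP; exists y, (y^-1 * x)%g; split; rewrite ?mulVKg //.
    by have := group_closedV gH xy; rewrite invgM invgK.
exists [fset x in C | majority A H0 x].
set C' := [fset x in C | _].
have C'C : C' `<=` C by apply: fset_sub.
have C'Hmaj x : x \in fsmul C' H -> majority A H0 x.
  move=> /fsmulP[y [h [yC' hH ->]]].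
  move: yC'; rewrite !inE => /andP[_ ymaj].
  by apply: majorityM => //; apply: (fsubsetP HH0).
have majC'H x : x \in A -> majority A H0 x -> x \in fsmul C' H.
  move=> xA xmaj; have [y yC xyH] := covC x xA.
  apply/fsmulP; exists y, (y^-1 * x)%g; split; rewrite ?mulVKg //; last first.
    by have := group_closedV gH xyH; rewrite invgM invgK.
  rewrite !inE yC /= -[y](mulVKg x); apply: majorityM => //.
  exact: (fsubsetP HH0).
(* Points of [C' H] are majority points, and majority points of [A] lie in [C' H]; the symmetric
   difference thus consists of disagreements. *)
have SA : #|` fsymdiff A (fsmul C' H)| * q <= #|` A|.*2.
  apply: (card_disagree gH0 H0q) => x; rewrite in_fsymdiff.
  case xA: (x \in A) => /= xC'H; last by rewrite C'Hmaj.
  by apply: contra xC'H => /eqP maj; apply: majC'H.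
move: SA; move: #|` fsymdiff _ _| => s SA; split=> //; last by nia.
have kN0 : 0 < 4 * k * N ^ 2.
  by have := leq_trans A0 leA; rewrite muln_gt0 => /andP[].
rewrite -(leq_pmul2l kN0).
have : s * (8 * k * N ^ 2 * e) <= s * q by rewrite leq_mul2l qkNe orbT.
by move: kN0 leA; rewrite -!mulnn; nia.
Qed.

(** * Stabilizers and the choice of scales *)

(** A separated subset of [A] of this size would carry a tree that stability forbids. *)
Definition covering_number (k r p : nat) : nat :=
  (4 * k * p) ^ ladder_height (r + r.+1).

Lemma stabilizer_covers (G : groupType) (A : {fset G}) (r k p q : nat) :
  A != fset0 -> stable r A -> #|` fsmul A A| <= k * #|` A| ->
  0 < k -> 1 < p -> 2 * p <= q ->
  (forall h, shift A h * p <= #|` A| -> shift A h * q <= #|` A|) ->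
  exists H0 : {fset G},
    [/\ group_closed [in H0], {in H0, forall h, shift A h * q <= #|` A|} &
        #|` A| <= covering_number k r p * #|` H0|].
Proof.
rewrite -cardfs_gt0 => A0 stA AAk k0 p1 pq gap.
(* Membership in [A^-1 A] only makes the set finite: a shift below [|A|] forces [A] and [A h] to
   meet. *)
pose H0 := [fset h in fsmul (fsinv A) A | shift A h * q <= #|` A|].
have inH0 h : (h \in H0) = (shift A h * p <= #|` A|).
  apply/idP/idP => [|hp].
    rewrite !inE => /andP[_]; apply: leq_trans; rewrite leq_mul2l; lia.
  rewrite !inE gap // andbT.
  have [|/fset0Pn[x]] := eqVneq (A `\` fsymdiff A (rtranslate A h)) fset0.
    move=> /eqP; rewrite fsetD_eq0 => /fsubset_leq_card.
    rewrite -/(shift A h); nia.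
  rewrite inE in_fsymdiff in_rtranslate => /andP[/[swap] xA].
  rewrite xA negbK => xhA; apply/fsmulP; exists ((x * h^-1)^-1)%g, x.
  by split=> //; [apply/imfsetP; exists (x * h^-1)%g | rewrite invgM invgK mulgVK].
have gH0 : group_closed [in H0].
  split; first by rewrite inH0 shift1.
  (* Two shifts of at most [|A| / q] add up to at most [|A| / p], as [2 p <= q]. *)
  move=> g h; rewrite !inH0 => /gap gq /gap hq.
  have := shiftM A g h^-1%g; rewrite shiftV => le_gh.
  rewrite -(leq_pmul2l (isT : 0 < 2)) mulnCA.
  by apply: leq_trans (leq_mul le_gh pq) _; rewrite mulnDl; lia.
exists H0; split=> //; first by move=> h; rewrite inH0 => /gap.
have [g|g h|F [FA sepF covF]] :=
  @maximal_separated _ A (fun g h => (g * h^-1)%g \in H0).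
- by rewrite mulgV; case: gH0.
- by apply/idP/idP => /(group_closedV gH0); rewrite invgM invgK.
have ltF : #|` F| < covering_number k r p.
  rewrite ltnNge; apply/negP => szF.
  apply: (stable_no_tree stA (separated_tree FA k0 (ltnW p1) AAk _ szF)).
  by move=> g h gF hF; rewrite -inH0; apply: sepF.
apply: (@leq_trans (#|` H0| * #|` F|)); last by rewrite mulnC leq_mul2r ltnW ?orbT.
apply: leq_trans (card_fsmul_le _ _); apply/fsubset_leq_card/fsubsetP => g gA.
have [f fF gf] := covF g gA; apply/fsmulP; exists (g * f^-1)%g, f.
by rewrite mulgVK.
Qed.

(** The sum dominates every lower bound on [q] required by [stabilizer_covers] and
    [subgroup_structure]. *)
Definition fine_scale (k r e p : nat) : nat :=
  8 * k * covering_number k r p ^ 2 * e + 2 * p + 2 * e + 3.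

(** Chosen so that the hypothesis of [scale_gap] holds with equality; the start [2] ensures
    [1 < p]. *)
Fixpoint scale (k r e i : nat) : nat :=
  if i is j.+1 then 2 ^ (ladder_height (r + r.+1)).+3 * fine_scale k r e (scale k r e j)
  else 2.

Lemma stable_small_doubling (k r e : nat) : 0 < k ->
  exists n : nat, forall (G : groupType) (A : {fset G}),
    A != fset0 -> stable r A -> #|` fsmul A A| <= k * #|` A| ->
    exists H C : {fset G},
      [/\ group_closed [in H], H `<=` fsmul A (fsinv A), C `<=` A,
          #|` C| <= n & A `<=` fsmul C H] /\
      exists C' : {fset G},
        [/\ C' `<=` C, e * #|` fsymdiff A (fsmul C' H)| <= #|` H| &
            e * #|` fsymdiff A (fsmul C' H)| <= #|` A|].
Proof.
move=> k0; set m := ladder_height (r + r.+1).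
pose bound i := 8 * k ^ 2 * covering_number k r (scale k r e i) ^ 2.
(* The good scale depends on [A], but only [m] scales occur. *)
exists (\max_(i < m) bound i) => G A A0 stA AAk.
have [//|i im gap] := @scale_gap _ A r (scale k r e)
  (fun i => fine_scale k r e (scale k r e i)) stA.
have p1 : 1 < scale k r e i.
  case: i {im gap} => [|i] //=; rewrite /fine_scale.
  by have := expn_gt0 2 m.+3; rewrite -/m; nia.
have [|H0 [gH0 H0q AN]] := stabilizer_covers A0 stA AAk k0 p1 _ gap.
  by rewrite /fine_scale; lia.
have [|||H [C [[gH HA CA leC AC] C'P]]] :=
  @subgroup_structure _ A H0 k _ _ e A0 AAk gH0 H0q AN.
- by rewrite /fine_scale; lia.
- by rewrite /fine_scale; lia.
- by rewrite /fine_scale /covering_number; lia.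
exists H, C; split=> //; split=> //; apply: leq_trans leC _.
exact: (leq_bigmax (F := fun i : 'I_m => bound i) (Ordinal im)).
Qed.

(** * Passage to real constants *)

Import Order.TTheory GRing.Theory Num.Theory.
Local Open Scope ring_scope.

Theorem theoremA (R : realType) (K eps : R) (r : nat)
    (hK : 1 <= K) (heps : 0 < eps) (hr : (2 <= r)%N) :
  exists n : nat,
    forall (G : groupType) (A : {fset G}),
      A != fset0 ->
      stable r A ->
      #|` fsmul (fsmul A A) A|%:R <= K * #|` A|%:R ->
      exists H C : {fset G},
        [/\ group_closed [in H],
            H `<=` fsmul A (fsinv A),
            C `<=` A,
            (#|` C| <= n)%N &
            A `<=` fsmul C H] /\
        exists C' : {fset G},
          [/\ C' `<=` C,
              #|` fsymdiff A (fsmul C' H)|%:R <= eps * #|` H|%:R &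
              #|` fsymdiff A (fsmul C' H)|%:R <= eps * K ^+ 2 * #|` A|%:R].
Proof.
pose k := (Num.trunc K).+1; pose e := (Num.trunc eps^-1).+1.
have Kk : K <= k%:R by rewrite ltW // truncnS_gt.
have eps_e : 1 <= eps * e%:R.
  by rewrite -ler_pdivrMl // mulr1 ltW // truncnS_gt.
have [//|n nP] := @stable_small_doubling k r e.
exists n => G A A0 stA AAA.
(* Right multiplication by an element of [A] embeds [A A] into [A A A]. *)
have AAk : (#|` fsmul A A| <= k * #|` A|)%N.
  have [a aA] := fset0Pn _ A0.
  apply: (@leq_trans #|` fsmul (fsmul A A) A|).
    apply: (leq_card_in_fset (f := fun x => (x * a)%g)) => [x xAA|? ? _ _ /mulIg//].
    exact: in_fsmul.
  rewrite -(ler_nat R) natrM; apply: le_trans AAA _.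
  by rewrite ler_wpM2r.
have [H [C [HCP [C' [C'C SH SA]]]]] := nP G A A0 stA AAk.
have small s t : (e * s <= t)%N -> s%:R <= eps * t%:R :> R.
  rewrite -(ler_nat R) natrM => est.
  apply: (@le_trans _ _ (eps * (e%:R * s%:R))); last by rewrite ler_pM2l.
  by rewrite mulrA ler_peMl.
exists H, C; split=> //; exists C'; split=> //; first exact: small.
(* The bound [eps |A|] suffices because [1 <= K ^+ 2]. *)
apply: le_trans (small _ _ SA) _; rewrite ler_wpM2r //.
by apply: ler_peMr; [exact: ltW|exact: exprn_ege1].
Qed.
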